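(* Let $K\subseteq\mathbf{R}^n$ be a nonempty closed set and let $f=(f_1,\dots,f_s):\mathbf{R}^n\to\mathbf{R}^s$ be a vector polynomial with $\deg f_i=d_i\ge 1$ for $i=1,\dots,s$. If $\mathrm{PVOP}(K,f)$ is strongly regular and $f$ is bounded from below on $K$, then $SOL^{s}(K,f)$ is nonempty and $SOL^{w}(K,f)$ is compact.
   Context: $\mathbf{R}^s_+$ is the nonnegative orthant. For a nonempty closed set $C\subseteq\mathbf{R}^n$ and a vector polynomial $h:\mathbf{R}^n\to\mathbf{R}^s$, $\mathrm{PVOP}(C,h)$ is the problem of minimizing $h$ over $C$ with respect to $\mathbf{R}^s_+$; $SOL^{s}(C,h)$ (Pareto efficient solutions) is the set of $x^*\in C$ such that $h(x)-h(x^* )\notin-\mathbf{R}^s_+\setminus\{0\}$ for all $x\in C$, and $SOL^{w}(C,h)$ (weak Pareto efficient solutions) is the set of $x^*\in C$ such that $h(x)-h(x^* )\notin-\mathrm{int}\,\mathbf{R}^s_+$ for all $x\in C$. The asymptotic cone of $K$ is $K_\infty=\{v\in\mathbf{R}^n:\text{ there exist } t_k\to+\infty \text{ and } x_k\in K \text{ with } x_k/t_k\to v\}$. For a vector polynomial $p=(p_1,\dots,p_s)$ with $\deg p_i=d_i$, $p^\infty=(p_1^\infty,\dots,p_s^\infty)$ where $p_i^\infty(x)=\lim_{\lambda\to+\infty}p_i(\lambda x)/\lambda^{d_i}$. $\mathrm{PVOP}(K,f)$ is strongly regular if $SOL^{w}(K_\infty,f^\infty)$ is bounded (the empty set counts as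 bounded). $f$ is bounded from below on $K$ if there is $r\in\mathbf{R}^s$ with $f(x)\in r+\mathbf{R}^s_+$ for all $x\in K$. *)

(* Defs.v *)
From HB Require Import structures.
From mathcomp Require Import all_boot all_order all_algebra.
From mathcomp Require Import all_classical all_reals all_analysis.
(* The notations of mpoly clash with those of mathcomp-analysis. *)
From mathcomp Require mpoly.
Import -(notations) mathcomp.multinomials.mpoly.

Set Implicit Arguments.
Unset Strict Implicit.
Unset Printing Implicit Defensive.

Import Order.TTheory GRing.Theory Num.Theory.
Import numFieldNormedType.Exports.

Local Open Scope classical_set_scope.
Local Open Scope ring_scope.

Definition orthant (R : realType) (s : nat) : set 'rV[R]_s :=
  [set y | forall i, 0 <= y ord0 i].

Definition pareto_sol (R : realType) (n s : nat) (C : set 'rV[R]_n)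
    (h : 'rV[R]_n -> 'rV[R]_s) : set 'rV[R]_n :=
  [set x0 | C x0 /\ forall x, C x ->
    ~ ([set - y | y in @orthant R s] `\` [set 0]) (h x - h x0)].

Definition weak_pareto_sol (R : realType) (n s : nat) (C : set 'rV[R]_n)
    (h : 'rV[R]_n -> 'rV[R]_s) : set 'rV[R]_n :=
  [set x0 | C x0 /\ forall x, C x ->
    ~ [set - y | y in interior (@orthant R s)] (h x - h x0)].

Definition asymptotic_cone (R : realType) (n : nat) (K : set 'rV[R]_n) :
    set 'rV[R]_n :=
  [set v | exists (t : nat -> R) (x : nat -> 'rV[R]_n),
    [/\ t @ \oo --> +oo, forall k, K (x k)
      & (fun k => (t k)^-1 *: x k) @ \oo --> v]].

(* mmeasure mdeg p, written msize p in multinomials, is the total degree plus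
   one, and 0 for p = 0. *)
Definition total_degree (R : realType) (n : nat) (p : mpoly n R) : nat :=
  (mmeasure mdeg p).-1.

Definition poly_map (R : realType) (n s : nat) (p : 'I_s -> mpoly n R)
    (x : 'rV[R]_n) : 'rV[R]_s :=
  \row_i meval (x ord0) (p i).

Definition poly_map_infty (R : realType) (n s : nat) (p : 'I_s -> mpoly n R)
    (x : 'rV[R]_n) : 'rV[R]_s :=
  \row_i lim ((poly_map p (l *: x) ord0 i / l ^+ total_degree (p i))
                @[l --> +oo]).

Definition strongly_regular (R : realType) (n s : nat) (K : set 'rV[R]_n)
    (f : 'I_s -> mpoly n R) : Prop :=
  bounded_set (weak_pareto_sol (asymptotic_cone K) (poly_map_infty f)).

Definition bounded_from_below (R : realType) (n s : nat) (K : set 'rV[R]_n)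
    (h : 'rV[R]_n -> 'rV[R]_s) : Prop :=
  exists r : 'rV[R]_s, forall x, K x -> [set r + y | y in @orthant R s] (h x).

(* Main.v *)
(* Since f is bounded from below on K, each f_i^oo is nonnegative on the cone
   K_oo. Hence any v in K_oo with f_i^oo(v) = 0 for some i is, together with the
   whole ray it spans, weakly efficient for (K_oo, f^oo), and strong regularity
   forces v = 0. So every f_i is coercive on K: directions of an unbounded
   sequence in a sublevel set would accumulate at some v <> 0 in K_oo with
   f_i^oo(v) <= 0. A minimizer over K of the sum of the f_i is efficient, and for
   any x1 in K each weakly efficient point lies in one of the finitely many
   bounded sets {x in K | f_i(x) <= f_i(x1)}. *)
Require Import Defs.
From mathcomp Require Import all_boot all_order all_algebra.
From mathcomp Require Import all_classical all_reals all_analysis.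
From mathcomp Require mpoly.
Import numFieldNormedType.Exports.
Import -(notations) mathcomp.multinomials.mpoly.
Import Order.TTheory GRing.Theory Num.Theory.
Local Open Scope classical_set_scope.
Local Open Scope ring_scope.

Set Implicit Arguments.
Unset Strict Implicit.
Unset Printing Implicit Defensive.

(** * Efficiency in coordinates *)

Lemma interior_orthantE (R : realType) (s : nat) :
  interior (@orthant R s) = [set y | forall i, 0 < y ord0 i].
Proof.
apply/seteqP; split => y /=.
  move=> /nbhs_ballP[e /= e0 ye] i.
  (* Lowering every coordinate by [e / 2] stays in the ball, hence in the orthant, so each
     coordinate of [y] is at least [e / 2]. *)
  have : @orthant R s (y - const_mx (e / 2)).
    apply: ye; split=> // j k; rewrite !mxE ord1 /ball /= opprB addrC subrK.
    by rewrite gtr0_norm ?divr_gt0// ltr_pdivrMr// ltr_pMr// ltr1n.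
  by move=> /(_ i); rewrite !mxE subr_ge0; apply: lt_le_trans; rewrite divr_gt0.
move=> y0; have yE i : \forall z \near y, 0 <= (z : 'rV[R]_s) ord0 i.
  have : \forall z \near y ord0 i, 0 <= z.
    by apply: filterS (lt_nbhsr (y0 i)) => z /ltW.
  exact: coord_continuous.
exact: (filter_forall (nbhs_filter y) yE).
Qed.

Lemma weak_pareto_solP {R : realType} {n s : nat} {C : set 'rV[R]_n}
    {h : 'rV[R]_n -> 'rV[R]_s} {x0 : 'rV[R]_n} :
  weak_pareto_sol C h x0 <->
  C x0 /\ forall x, C x -> exists i, h x0 ord0 i <= h x ord0 i.
Proof.
rewrite /weak_pareto_sol interior_orthantE; split=> -[Cx0 x0P]; split=> // x Cx.
  apply: contrapT => /forallNP hx; apply: (x0P x Cx).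
  exists (h x0 - h x) => [i|]; last by rewrite opprB.
  by rewrite !mxE subr_gt0 ltNge; apply/negP; exact: hx.
move=> [y y0 yE]; have [i] := x0P x Cx.
apply/negP; rewrite -ltNge -subr_gt0.
have := congr1 (fun z : 'rV[R]_s => - z ord0 i) yE.
by rewrite !mxE opprB opprK => <-.
Qed.

(** If [x] dominated [x0], the coordinates of [h x0 - h x] would be nonnegative with sum at most 0,
    so all would vanish, against [h x - h x0] being nonzero. *)
Lemma sum_minimizer_pareto_sol (R : realType) (n s : nat) (C : set 'rV[R]_n)
    (h : 'rV[R]_n -> 'rV[R]_s) (x0 : 'rV[R]_n) :
  C x0 -> (forall x, C x -> \sum_i h x0 ord0 i <= \sum_i h x ord0 i) ->
  pareto_sol C h x0.
Proof.
move=> Cx0 x0min; split=> // x Cx -[[y y0 yE] hx0]; apply: hx0.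
have y00 i : h x ord0 i - h x0 ord0 i = - y ord0 i.
  by have := congr1 (fun z : 'rV[R]_s => z ord0 i) yE; rewrite !mxE => ->.
have sy : \sum_i y ord0 i <= 0.
  rewrite -oppr_ge0 -sumrN -(eq_bigr _ (fun i _ => y00 i)) big_split/= sumrN.
  by rewrite subr_ge0 x0min.
have /eqP : \sum_i y ord0 i = 0 by apply/le_anti; rewrite sy sumr_ge0.
rewrite psumr_eq0 => [/allP y_eq0|i _]; last exact: y0.
rewrite -yE; apply/rowP => i; rewrite !mxE.
by rewrite (eqP (y_eq0 i _)) ?oppr0// mem_index_enum.
Qed.

(** * Homogenization and leading forms *)

Section Homogenization.
Context {R : realType} {n : nat}.
Implicit Types (p : mpoly n R) (x y v : 'rV[R]_n).

(* Jointly continuous in (y, u), equal to p(x) / t^d at (x / t, 1 / t) and to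
   p^oo(y) at (y, 0). *)
Definition homogenize p y (u : R) : R :=
  \sum_(m <- msupp p)
    mcoeff m p * (u ^+ (total_degree p - mdeg m) * \prod_i y ord0 i ^+ m i).

Lemma homogenizeZ p a y u :
  homogenize p (a *: y) (a * u) = a ^+ total_degree p * homogenize p y u.
Proof.
rewrite /homogenize mulr_sumr [LHS]big_seq [RHS]big_seq.
apply: eq_bigr => m mp; rewrite [RHS]mulrCA; congr (_ * _).
under eq_bigr do rewrite mxE exprMn.
(* The exponents of [a] add up to [total_degree p]: the natural-number subtraction does not
   truncate, since monomials of the support have degree below [mmeasure mdeg p]. *)
rewrite big_split/= prodrXr -mdegE exprMn mulrACA -exprD subnK//.
have := msize_mdeg_lt mp; rewrite /total_degree.
by case: (mmeasure _ _).
Qed.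

Lemma homogenize1 p y : homogenize p y 1 = meval (y ord0) p.
Proof.
by rewrite mevalE; apply: eq_bigr => m _; rewrite expr1n mul1r.
Qed.

Lemma homogenizeV p t x : t != 0 ->
  homogenize p (t^-1 *: x) t^-1 = meval (x ord0) p / t ^+ total_degree p.
Proof.
by move=> t0; rewrite -[X in homogenize _ _ X]mulr1 homogenizeZ homogenize1 exprVn mulrC.
Qed.

Lemma cvg_homogenize {T : Type} {F : set_system T} {FF : Filter F} p
    (y_ : T -> 'rV[R]_n) (u_ : T -> R) y u :
  y_ @ F --> y -> u_ @ F --> u ->
  homogenize p (y_ k) (u_ k) @[k --> F] --> homogenize p y u.
Proof.
move=> yF uF; apply: cvg_big => [|m _]; first exact: add_continuous.
apply: cvgM; first exact: cvg_cst.
apply: cvgM; first exact: continuous_cvg (@exprn_continuous _ _ _) uF.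
apply: cvg_big => [|i _]; first exact: mul_continuous.
have yi : y_ k ord0 i @[k --> F] --> y ord0 i.
  exact: (cvg_comp _ _ yF (@coord_continuous _ _ _ _ _ y)).
exact: (cvg_comp _ _ yi (@exprn_continuous R _ _)).
Qed.

(** The quotient is eventually [homogenize p] at [(x k / t k, 1 / t k)], which tends to [(v, 0)]. *)
Lemma cvg_poly_asymptotic {T : Type} {F : set_system T} {FF : Filter F} p
    (t : T -> R) (x : T -> 'rV[R]_n) v :
  t @ F --> +oo -> (t k)^-1 *: x k @[k --> F] --> v ->
  meval (x k ord0) p / t k ^+ total_degree p @[k --> F] --> homogenize p v 0.
Proof.
move=> ty xv.
have t0 : \forall k \near F, 0 < t k by exact: cvgry_gt.
have tV : (t k)^-1 @[k --> F] --> 0 by apply/(gtr0_cvgV0 t0).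
apply: cvg_trans (cvg_homogenize (p := p) xv tV).
by apply: near_eq_cvg; apply: filterS t0 => k /lt0r_neq0 /homogenizeV ->.
Qed.

Lemma cvg_polyB_asymptotic {T : Type} {F : set_system T} {FF : Filter F} p
    (t : T -> R) (x : T -> 'rV[R]_n) v c : (1 <= total_degree p)%N ->
  t @ F --> +oo -> (t k)^-1 *: x k @[k --> F] --> v ->
  (meval (x k ord0) p - c) / t k ^+ total_degree p @[k --> F] -->
    homogenize p v 0.
Proof.
move=> d0 ty xv; rewrite -[homogenize p v 0]subr0.
under eq_cvg do rewrite mulrBl.
apply: cvgB; first exact: cvg_poly_asymptotic.
have t0 : \forall k \near F, 0 < t k by exact: cvgry_gt.
have tV : (t k)^-1 @[k --> F] --> 0 by apply/(gtr0_cvgV0 t0).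
(* Positive degree makes the constant [c] vanish in the limit. *)
have -> : 0 = c * 0 ^+ total_degree p by rewrite expr0n gtn_eqF// mulr0.
under eq_cvg do rewrite -exprVn.
by apply: cvgM; [exact: cvg_cst|exact: continuous_cvg (@exprn_continuous _ _ _) tV].
Qed.

End Homogenization.

Lemma poly_mapE (R : realType) (n s : nat) (f : 'I_s -> mpoly n R)
    (x : 'rV[R]_n) i :
  poly_map f x ord0 i = meval (x ord0) (f i).
Proof. by rewrite mxE. Qed.

Lemma poly_map_inftyE (R : realType) (n s : nat) (f : 'I_s -> mpoly n R)
    (v : 'rV[R]_n) i :
  poly_map_infty f v ord0 i = homogenize (f i) v 0.
Proof.
rewrite mxE; apply/cvg_lim; first exact: Rhausdorff.
under eq_cvg do rewrite poly_mapE.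
apply: (@cvg_poly_asymptotic _ _ _ _ _ (f i) id (fun l => l *: v)).
  exact: cvg_id.
(* For [l > 0] the rescaled point [l^-1 *: (l *: v)] is [v] itself. *)
apply: cvg_near_cst.
have : \forall l \near +oo, (0 : R) < l by exact: nbhs_pinfty_gt.
by apply: filterS => l l0; rewrite scalerA mulVf ?scale1r// lt0r_neq0.
Qed.

(** Evaluation is the slice [u = 1] of the jointly continuous homogenization. *)
Lemma continuous_meval (R : realType) (n : nat) (p : mpoly n R) :
  continuous (fun x : 'rV[R]_n => meval (x ord0) p).
Proof.
move=> x.
have : homogenize p y 1 @[y --> x] --> homogenize p x 1.
  exact: (cvg_homogenize (F := nbhs x) (y_ := id) (@cvg_id _ _) (cvg_cst _)).
by under eq_cvg do rewrite homogenize1; rewrite homogenize1.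
Qed.

(** * Asymptotic directions and coercivity *)

Lemma asymptotic_coneZ (R : realType) (n : nat) (K : set 'rV[R]_n) a v :
  0 < a -> asymptotic_cone K v -> asymptotic_cone K (a *: v).
Proof.
move=> a0 [t [x [ty Kx xv]]]; exists (fun k => a^-1 * t k), x; split=> //.
  apply/cvgryPge => A; move/cvgryPge : ty => /(_ (a * A)).
  by apply: filterS => k; rewrite ler_pdivlMl.
under eq_cvg do rewrite invfM invrK -scalerA.
by apply: cvgZ => //; exact: cvg_cst.
Qed.

Lemma bounded_set_le (R : realFieldType) (V : normedModType R) (A : set V) M :
  (forall x, A x -> `|x| <= M) -> bounded_set A.
Proof.
move=> AM; exists M; split; first exact: num_real.
by move=> N MN x Ax /=; apply: le_trans (AM x Ax) (ltW MN).
Qed.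

(** Normalize points of [S] of growing norm; compactness of the unit sphere gives a cluster point
    [v] of norm 1, and [t] is the norm along a selection converging to [v]. *)
Lemma unbounded_asymptotic_direction (R : realType) (n : nat)
    (S : set 'rV[R]_n) : ~ bounded_set S ->
  exists (t : nat -> R) (x : nat -> 'rV[R]_n) (v : 'rV[R]_n),
    [/\ t @ \oo --> +oo, forall k, S (x k),
      (t k)^-1 *: x k @[k --> \oo] --> v & v != 0].
Proof.
move=> S_unb.
have /choice[z zP] : forall k : nat, exists x, S x /\ k%:R < `|x|.
  move=> k; apply: contrapT => /forallNP Sk; apply: S_unb.
  apply: (@bounded_set_le _ _ _ k%:R) => x Sx.
  by rewrite leNgt; apply/negP => kx; apply: (Sk x).
have z0 k : 0 < `|z k| by apply: le_lt_trans (zP k).2.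
pose sphere := [set x : 'rV[R]_n | `|x| = 1].
have sphere_compact : compact sphere.
  apply: bounded_closed_compact.
    by apply: (@bounded_set_le _ _ _ 1) => x /= ->.
  apply: (@preimage_closed _ _ (fun x : 'rV[R]_n => `|x|) [set 1]).
    by move=> x _; exact: norm_continuous.
  exact: closed_eq.
have zs : \forall k \near \oo, sphere (`|z k|^-1 *: z k).
  by apply: nearW => k; rewrite /sphere/= normrZ normfV normr_id mulVf ?gt_eqF.
have [v [v1 vcl]] := sphere_compact ((fun k => `|z k|^-1 *: z k) @ \oo) _ zs.
(* [g] need not be increasing: [k <= g k] already forces the norms to infinity. It comes from
   meeting the tail of index [k] with the ball of radius [1 / (k + 1)] around [v]. *)
have /choice[g gP] : forall k : nat, exists j : nat,
    (k <= j)%N /\ `|v - `|z j|^-1 *: z j| < k.+1%:R^-1.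
  move=> k; have e0 : 0 < k.+1%:R^-1 :> R by rewrite invr_gt0.
  have [_ [[j /= kj <-] vj]] := vcl
    [set `|z j|^-1 *: z j | j in [set j | (k <= j)%N]] _
    (filterS (fun j kj => ex_intro2 _ _ j kj erefl) (nbhs_infty_ge k))
    (nbhsx_ballx v _ e0).
  by exists j; split=> //; move: vj; rewrite -ball_normE.
exists (fun k => `|z (g k)|), (z \o g), v; split.
- apply/cvgryPge => A; near=> k.
  apply: le_trans (ltW (zP (g k)).2).
  apply: (@le_trans _ _ k%:R); last by rewrite ler_nat (gP k).1.
  near: k; exact: nbhs_infty_ger.
- by move=> k; exact: (zP (g k)).1.
- apply/cvgrPdist_lt => e e0; near=> k.
  apply: lt_trans (gP k).2 _.
  near: k; exact: (near_infty_natSinv_lt (PosNum e0)).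
- by rewrite -normr_gt0 v1.
Unshelve. all: by end_near. Qed.

(** Along a sequence defining [v], the quotients [(p(x_k) - c) / t_k^d] are eventually nonnegative
    and tend to the leading form at [v]. *)
Lemma asymptotic_cone_homogenize_ge0 (R : realType) (n : nat)
    (K : set 'rV[R]_n) (p : mpoly n R) (c : R) (v : 'rV[R]_n) :
  (1 <= total_degree p)%N -> (forall x, K x -> c <= meval (x ord0) p) ->
  asymptotic_cone K v -> 0 <= homogenize p v 0.
Proof.
move=> d0 cp [t [x [ty Kx xv]]].
apply: cvgr_to_ge (cvg_polyB_asymptotic c d0 ty xv) _.
apply: filterS (cvgry_gt ty 0) => k t0.
by rewrite divr_ge0 ?exprn_ge0 ?subr_ge0 ?cp// ltW.
Qed.

(** On an unbounded sublevel set the same quotients are eventually nonpositive, giving a nonzero [v]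
    in the cone where the leading form is at most 0. *)
Lemma bounded_sublevel (R : realType) (n : nat) (K : set 'rV[R]_n)
    (p : mpoly n R) (c : R) :
  (1 <= total_degree p)%N ->
  (forall v, asymptotic_cone K v -> homogenize p v 0 <= 0 -> v = 0) ->
  bounded_set [set x | K x /\ meval (x ord0) p <= c].
Proof.
move=> d0 p_gt0; apply: contrapT => /unbounded_asymptotic_direction.
move=> [t [x [v [ty Sx xv /eqP]]]]; apply; apply: p_gt0.
  by exists t, x; split=> // k; exact: (Sx k).1.
apply: cvgr_to_le (cvg_polyB_asymptotic c d0 ty xv) _.
apply: filterS (cvgry_gt ty 0) => k t0.
by rewrite pmulr_lle0 ?invr_gt0 ?exprn_gt0// subr_le0 (Sx k).2.
Qed.

(** If some [x] in [K] is strictly better than [x0] in all of the finitely many objectives, by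
    continuity it is also strictly better than every point near [x0]. *)
Lemma closed_weak_pareto_sol (R : realType) (n s : nat) (K : set 'rV[R]_n)
    (f : 'I_s -> mpoly n R) :
  closed K -> closed (weak_pareto_sol K (poly_map f)).
Proof.
rewrite !closedE => K_closed x0 /= x0W; apply/weak_pareto_solP; split.
  apply: K_closed => nK; apply: x0W.
  by apply: filterS nK => x nKx [/nKx].
move=> x Kx; apply: contrapT => /forallNP fx; apply: x0W.
have fx_lt i : \forall y \near x0,
    meval (x ord0) (f i) < meval ((y : 'rV[R]_n) ord0) (f i).
  apply: (cvgr_gt _ (@continuous_meval _ _ (f i) x0)).
  by have /negP := fx i; rewrite -ltNge !poly_mapE.
apply: filterS (filter_forall (nbhs_filter x0) fx_lt) => y fy.
move=> /weak_pareto_solP[_ /(_ x Kx)[i]].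
by rewrite !poly_mapE leNgt fy.
Qed.

Lemma strongly_regular_homogenize_gt0 (R : realType) (n s : nat)
    (K : set 'rV[R]_n) (f : 'I_s -> mpoly n R) :
  strongly_regular K f ->
  (forall i v, asymptotic_cone K v -> 0 <= homogenize (f i) v 0) ->
  forall i v, asymptotic_cone K v -> homogenize (f i) v 0 <= 0 -> v = 0.
Proof.
move=> /pinfty_ex_gt0[M M0 WM] f_ge0 i v Kv fv.
apply: contrapT => /eqP; rewrite -normr_gt0 => v0.
(* Chosen so that [a *: v] has norm [M + 1], beyond the bound [M] on the weakly efficient set. *)
pose a := (M + 1) / `|v|.
have a0 : 0 < a by rewrite divr_gt0// addr_gt0.
have : weak_pareto_sol (asymptotic_cone K) (poly_map_infty f) (a *: v).
  apply/weak_pareto_solP; split; first exact: asymptotic_coneZ.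
  (* The same index [i] serves for every [w]: by homogeneity the leading form of [f i] is at most 0
     at [a *: v], and it is nonnegative at [w]. *)
  move=> w Kw; exists i; rewrite !poly_map_inftyE.
  apply: le_trans (f_ge0 i w Kw).
  by rewrite -[X in homogenize _ _ X](mulr0 a) homogenizeZ pmulr_rle0 ?exprn_gt0.
move=> /WM /=; rewrite normrZ gtr0_norm// divfK ?gt_eqF//.
by rewrite gerDl ler10.
Qed.

Theorem corollary5p3 (R : realType) (n s : nat) (K : set 'rV[R]_n)
    (f : 'I_s -> mpoly.mpoly n R)
    (K_nonempty : K !=set0) (K_closed : closed K)
    (f_deg : forall i, (1 <= total_degree (f i))%N)
    (f_regular : strongly_regular K f)
    (f_below : bounded_from_below K (poly_map f)) :
  pareto_sol K (poly_map f) !=set0 /\ compact (weak_pareto_sol K (poly_map f)).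
Proof.
have [x1 Kx1] := K_nonempty; have [r rP] := f_below.
have fr i x : K x -> r ord0 i <= meval (x ord0) (f i).
  by move=> /rP[y y0]; rewrite -poly_mapE => <-; rewrite mxE lerDl.
have f_ge0 i v : asymptotic_cone K v -> 0 <= homogenize (f i) v 0.
  exact: asymptotic_cone_homogenize_ge0 (fr i).
have f_bounded i c : bounded_set [set x | K x /\ meval (x ord0) (f i) <= c].
  apply: bounded_sublevel => //.
  exact: strongly_regular_homogenize_gt0 f_regular f_ge0 i.
split.
  pose F (x : 'rV[R]_n) := \sum_i meval (x ord0) (f i).
  suff [x0 Kx0 x0min] : exists2 x0, K x0 & forall x, K x -> F x0 <= F x.
    exists x0; apply: sum_minimizer_pareto_sol => // x Kx.
    under eq_bigr do rewrite poly_mapE.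
    by under [leRHS]eq_bigr do rewrite poly_mapE; exact: x0min.
  have F_cont : continuous F.
    apply: continuous_big => [|i _]; first exact: add_continuous.
    exact: continuous_meval.
  pose S := [set x | K x /\ F x <= F x1].
  have S_closed : closed S.
    apply: closedI => //; apply: (@preimage_closed _ _ F [set y | y <= F x1]).
      by move=> x _; exact: F_cont.
    exact: closed_le.
  (* With no objectives ([s = 0]), [F] is an empty sum and [x1] is a minimizer. *)
  have [i0 _|s0] := pickP 'I_s; last first.
    by exists x1 => // x _; rewrite /F !big_pred0.
  have S_bounded : bounded_set S.
    (* Bounding the other objectives below by [r], the inequality [F x <= F x1] puts [x] in a
       sublevel set of [f i0] alone. *)
    have := f_bounded i0 (F x1 - \sum_(j | j != i0) r ord0 j).
    apply: sub_boundedr => A SA x [Kx Fx]; apply: SA; split=> //.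
    rewrite lerBrDr; apply: le_trans Fx; rewrite /F [leRHS](bigD1 i0)//=.
    by rewrite lerD2l ler_sum// => j _; exact: fr.
  have [|x0 /set_mem[Kx0 Fx0] x0min] :=
    EVT_min_rV _ (bounded_closed_compact S_bounded S_closed)
      (continuous_subspaceT F_cont).
    by exists x1.
  exists x0 => // x Kx; have [Fx|/ltW Fx] := leP (F x) (F x1).
    by apply: x0min; rewrite inE.
  exact: le_trans Fx0 Fx.
apply: bounded_closed_compact; last exact: closed_weak_pareto_sol.
have /choice[M MP] : forall i, exists M, 0 < M /\
    forall x, K x -> meval (x ord0) (f i) <= meval (x1 ord0) (f i) -> `|x| <= M.
  move=> i; have /pinfty_ex_gt0[M M0 fM] := f_bounded i (meval (x1 ord0) (f i)).
  by exists M; split=> // x Kx fx; apply: fM.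
(* The [M i] are positive, so their sum dominates each one, whichever index [i] the comparison with
   [x1] produces. *)
apply: (@bounded_set_le _ _ _ (\sum_i M i)) => x /weak_pareto_solP[Kx].
move=> /(_ x1 Kx1)[i]; rewrite !poly_mapE => fx.
apply: le_trans ((MP i).2 x Kx fx) _.
by rewrite [leRHS](bigD1 i)//= lerDl sumr_ge0// => j _; exact: ltW (MP j).1.
Qed.
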